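(* Let $G$ be a finite group. Every element of $\mathrm{Aut}(\mathcal{D}(G))$ is flippable. Moreover, the flip of an automorphism is itself an automorphism, and flipping is an anti-isomorphism of the group $\mathrm{Aut}(\mathcal{D}(G))$ onto itself.
   Context: The base field $\mathbbm{k}$ is algebraically closed of characteristic zero. For a finite group $G$, $\mathbbm{k}^G$ is the linear dual of $\mathbbm{k}G$, with dual basis $\{e_g\}_{g\in G}$ and identity $\varepsilon=\sum_{g}e_g$; $\widehat{G}=\mathrm{Hom}(G,\mathbbm{k}^\times)$ is the group of group-like elements of $\mathbbm{k}^G$. The Drinfeld double $\mathcal{D}(G)$ is the Hopf algebra with basis $e_g\# h$ ($g,h\in G$), multiplication $(e_g\# g')(e_h\# h')=\delta_{g,\,g'hg'^{-1}}\,e_g\# g'h'$, unit $\varepsilon\# 1$, and coalgebra structure $(\mathbbm{k}^G)^{\mathrm{cop}}\otimes\mathbbm{k}G$. $\mathrm{Aut}(\mathcal{D}(G))$ is its group of Hopf algebra automorphisms. Every Hopf algebra morphism $\psi:\mathcal{D}(G)\to\mathcal{D}(H)$ ($G,H$ finite groups) is determined by its components $(p,u,r,v)$, where $u(a)=(\mathrm{id}\otimes\varepsilon)\psi(a\#1)\in\mathbbm{k}^H$, $p(a)=(\mathrm{ev}_1\otimes\mathrm{id})\psi(a\#1)\in\mathbbm{k}H$, $r(g)=(\mathrm{id}\otimes\varepsilon)\psi(\varepsilon\# g)\in\mathbbm{k}^H$, $v(g)=(\mathrm{ev}_1\otimes\mathrm{id})\psi(\varepsilon\# g)\in\mathbbm{k}H$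 for $a\in\mathbbm{k}^G$, $g\in G$ (here $\mathrm{ev}_1(f)=f(1)$ and $\varepsilon$ in the second tensor factor is the counit of $\mathbbm{k}H$); one has $\psi(a\# g)=u(a_{(1)})r(g)\# p(a_{(2)})v(g)$, with Sweedler notation in $(\mathbbm{k}^G)^{\mathrm{cop}}$. $\psi$ is called flippable if there is a Hopf algebra morphism $\mathcal{D}(H)\to\mathcal{D}(G)$ with components $(p^*,v^*,r^*,u^* )$, where $^*$ is the linear transpose (using $(\mathbbm{k}^G)^*=\mathbbm{k}G$, so $p^*:\mathbbm{k}^H\to\mathbbm{k}G$, $v^*:\mathbbm{k}^H\to\mathbbm{k}^G$, $r^*:\mathbbm{k}H\to\mathbbm{k}^G$, $u^*:\mathbbm{k}H\to\mathbbm{k}G$). That morphism is called the flip of $\psi$, and flipping is the map sending a flippable morphism to its flip. *)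

(* Defs.v *)
From HB Require Import structures.
From mathcomp Require Import all_boot all_algebra all_fingroup.
From mathcomp Require Import boolp.

Set Implicit Arguments.
Unset Strict Implicit.
Unset Printing Implicit Defensive.

Import GRing.Theory.
Local Open Scope ring_scope.

(* Both k^G and kG are represented by {ffun G -> k^o}: an element a of k^G is
   the function g |-> a(g), that is \sum_g a(g) e_g, and an element x of kG is
   the family of its coefficients, that is \sum_g x(g) g. Thus dirac g is e_g
   in k^G and g in kG, the constant 1 is the identity of k^G, and the pairing
   between k^G and kG is \sum_g a(g) x(g). *)
Definition dirac (k : fieldType) (I : finType) (i : I) : {ffun I -> k^o} :=
  [ffun j => (j == i)%:R].

(* The transpose of T : k{I} -> k{J} sends the functional a on k{J} to a \o T,
   here given by its values on the basis of k{I}. *)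
Definition transpose (k : fieldType) (I J : finType)
    (T : {ffun I -> k^o} -> {ffun J -> k^o}) :
    {ffun J -> k^o} -> {ffun I -> k^o} :=
  fun a => [ffun i => \sum_j a j * T (dirac k i) j].

(* x (g, h) is the coefficient of e_g # h in x. *)
Definition drinfeld (k : fieldType) (gT : finGroupType) : Type :=
  {ffun gT * gT -> k^o}.

HB.instance Definition _ (k : fieldType) (gT : finGroupType) :=
  Vector.copy (drinfeld k gT) {ffun gT * gT -> k^o}.

Section DoubleAlgebra.
Variables (k : fieldType) (gT : finGroupType).
Implicit Types (x y z : drinfeld k gT) (g h a b c : gT).

Definition dcoef x g h : k := (x : {ffun gT * gT -> k^o}) (g, h).

Definition mkdrinfeld (F : gT -> gT -> k) : drinfeld k gT :=
  [ffun t : gT * gT => F t.1 t.2 : k^o].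

Definition dbase g h : drinfeld k gT :=
  mkdrinfeld (fun g' h' => ((g' == g) && (h' == h))%:R).

(* (e_g # a)(e_g' # b) is nonzero only for g' = g ^ a, where
   g ^ a = a^-1 * g * a; see dbaseM below. *)
Definition dmul x y : drinfeld k gT :=
  mkdrinfeld (fun g c =>
    \sum_a dcoef x g a * dcoef y (g ^ a)%g (a^-1 * c)%g).

Definition done_ : drinfeld k gT := mkdrinfeld (fun _ h => (h == 1%g)%:R).

Lemma mkdrinfeldE F g h : dcoef (mkdrinfeld F) g h = F g h.
Proof. by rewrite /dcoef ffunE. Qed.

Lemma drinfeldP x y : (forall g h, dcoef x g h = dcoef y g h) -> x = y.
Proof. by move=> e; apply/ffunP=> -[g h]; apply: e. Qed.

Lemma dcoefD x y g h : dcoef (x + y) g h = dcoef x g h + dcoef y g h.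
Proof. by rewrite /dcoef ffunE. Qed.

Lemma dcoefZ (l : k) x g h : dcoef (l *: x) g h = l * dcoef x g h.
Proof. by rewrite /dcoef ffunE. Qed.

Lemma dmulA : associative dmul.
Proof.
move=> x y z; apply: drinfeldP => g c; rewrite !mkdrinfeldE.
under eq_bigr => a _ do rewrite mkdrinfeldE mulr_sumr.
under [RHS]eq_bigr => b _ do rewrite mkdrinfeldE mulr_suml.
rewrite [RHS]exchange_big /=; apply: eq_bigr => a _.
rewrite [RHS](reindex_inj (mulgI a)) /=; apply: eq_bigr => d _.
by rewrite mulKg conjgM invMg mulgA mulrA.
Qed.

Lemma dmul1x : left_id done_ dmul.
Proof.
move=> x; apply: drinfeldP => g c; rewrite !mkdrinfeldE (bigD1 1%g) //=.
rewrite big1 ?mkdrinfeldE ?eqxx ?mul1r ?conjg1 ?invg1 ?mul1g ?addr0 //.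
by move=> a /negPf na; rewrite mkdrinfeldE na mul0r.
Qed.

Lemma dmulx1 : right_id done_ dmul.
Proof.
move=> x; apply: drinfeldP => g c; rewrite !mkdrinfeldE (bigD1 c) //=.
rewrite big1 ?mkdrinfeldE ?mulVg ?eqxx ?mulr1 ?addr0 //.
by move=> a na; rewrite mkdrinfeldE -eq_mulVg1 (negPf na) mulr0.
Qed.

Lemma dmulDl : left_distributive dmul +%R.
Proof.
move=> x y z; apply: drinfeldP => g c; rewrite dcoefD !mkdrinfeldE -big_split /=.
by apply: eq_bigr => a _; rewrite dcoefD mulrDl.
Qed.

Lemma dmulDr : right_distributive dmul +%R.
Proof.
move=> x y z; apply: drinfeldP => g c; rewrite dcoefD !mkdrinfeldE -big_split /=.
by apply: eq_bigr => a _; rewrite dcoefD mulrDr.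
Qed.

Lemma done_neq0 : done_ != 0.
Proof.
apply/eqP=> /(congr1 (fun x => dcoef x 1%g 1%g)).
by rewrite mkdrinfeldE eqxx /dcoef ffunE => /eqP; rewrite oner_eq0.
Qed.

HB.instance Definition _ := GRing.Zmodule_isNzRing.Build (drinfeld k gT)
  dmulA dmul1x dmulx1 dmulDl dmulDr done_neq0.

Lemma dmulZl (l : k) x y : l *: (x * y) = l *: x * y.
Proof.
apply: drinfeldP => g c; rewrite dcoefZ !mkdrinfeldE mulr_sumr.
by apply: eq_bigr => a _; rewrite dcoefZ mulrA.
Qed.

HB.instance Definition _ :=
  GRing.Lmodule_isLalgebra.Build k (drinfeld k gT) dmulZl.

Lemma dmulZr (l : k) x y : l *: (x * y) = x * (l *: y).
Proof.
apply: drinfeldP => g c; rewrite dcoefZ !mkdrinfeldE mulr_sumr.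
by apply: eq_bigr => a _; rewrite dcoefZ mulrCA.
Qed.

HB.instance Definition _ :=
  GRing.Lalgebra_isAlgebra.Build k (drinfeld k gT) dmulZr.

Lemma dbaseM g g' h h' :
  dbase g g' * dbase h h' =
    if g == (g' * h * g'^-1)%g then dbase g (g' * h')%g else 0.
Proof.
apply: drinfeldP => b c; rewrite !mkdrinfeldE (bigD1 g') //=.
rewrite big1 ?addr0; last first.
  by move=> a /negPf na; rewrite mkdrinfeldE na andbF mul0r.
rewrite !mkdrinfeldE eqxx andbT -natrM mulnb.
have ->: (b ^ g' == h)%g = (b == g' * h * g'^-1)%g.
  rewrite -[in RHS](inj_eq (conjg_inj g')) [in RHS](conjgE (_ * _)).
  by rewrite !mulgA mulVg mul1g mulgVK.
have ->: (g'^-1 * c == h')%g = (c == g' * h')%g.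
  by rewrite -(inj_eq (mulgI g')) mulKVg.
have [->|nb] := eqVneq b g; case: (g == _) => /=;
  by rewrite ?mkdrinfeldE ?eqxx ?(negPf nb) /dcoef ?ffunE.
Qed.

Lemma dbase_sum x : x = \sum_t dcoef x t.1 t.2 *: dbase t.1 t.2.
Proof.
apply/ffunP => -[g h]; rewrite sum_ffunE (bigD1 (g, h)) //=.
rewrite big1 => [|[a b] nab].
  by rewrite !ffunE /= !eqxx [_ *: _]mulr1 addr0.
rewrite !ffunE /= [_ *: _](_ : _ = 0) //.
by move: nab; rewrite eq_sym xpair_eqE => /negPf->; rewrite [_ *: _]mulr0.
Qed.

End DoubleAlgebra.

(* D(G) \otimes D(G), with the basis (e_g # h) \otimes (e_g' # h') indexed by
   ((g, h), (g', h')). *)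
Definition dtensor (k : fieldType) (gT : finGroupType) : Type :=
  {ffun (gT * gT) * (gT * gT) -> k^o}.

HB.instance Definition _ (k : fieldType) (gT : finGroupType) :=
  Vector.copy (dtensor k gT) {ffun (gT * gT) * (gT * gT) -> k^o}.

Section DoubleHopf.
Variables (k : fieldType) (gT : finGroupType).
Implicit Types (x y : drinfeld k gT) (t : dtensor k gT).

Definition dotimes x y : dtensor k gT :=
  [ffun s : (gT * gT) * (gT * gT) =>
     dcoef x s.1.1 s.1.2 * dcoef y s.2.1 s.2.2 : k^o].

(* In k^G, the coproduct of e_g is the sum of the e_a \otimes e_b with
   a * b = g; the two factors are exchanged in (k^G)^cop. *)
Definition dcomul x : dtensor k gT :=
  \sum_(s : gT * gT) dcoef x s.1 s.2 *:
    \sum_(a : gT) dotimes (dbase k (a^-1 * s.1)%g s.2) (dbase k a s.2).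

Definition dcounit x : k := \sum_h dcoef x 1%g h.

(* S (e_g # h) = (1 # h^-1) * (S e_g # 1) = e_(h^-1 g^-1 h) # h^-1 *)
Definition dantipode x : drinfeld k gT :=
  \sum_(s : gT * gT) dcoef x s.1 s.2 *: dbase k ((s.1)^-1 ^ s.2)%g (s.2)^-1%g.

(* a # x *)
Definition dsharp (a x : {ffun gT -> k^o}) : drinfeld k gT :=
  mkdrinfeld (fun g h => a g * x h).

(* ev_1 \otimes id : D(G) -> kG *)
Definition ev1_id x : {ffun gT -> k^o} := [ffun h => dcoef x 1%g h].

(* id \otimes counit : D(G) -> k^G *)
Definition id_counit x : {ffun gT -> k^o} := [ffun g => \sum_h dcoef x g h].

End DoubleHopf.

Section Morphisms.
Variables (k : fieldType) (gT hT : finGroupType).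
Implicit Types psi : 'Hom(drinfeld k gT, drinfeld k hT).

Definition dtensor_map psi (t : dtensor k gT) : dtensor k hT :=
  \sum_(s : (gT * gT) * (gT * gT)) (t : {ffun _ -> k^o}) s *:
    dotimes (psi (dbase k s.1.1 s.1.2)) (psi (dbase k s.2.1 s.2.2)).

Definition hopf_morphism psi : Prop :=
  [/\ GRing.monoid_morphism psi,
      forall x, dcomul (psi x) = dtensor_map psi (dcomul x),
      forall x, dcounit (psi x) = dcounit x &
      forall x, dantipode (psi x) = psi (dantipode x)].

Definition comp_u psi (a : {ffun gT -> k^o}) : {ffun hT -> k^o} :=
  id_counit (psi (dsharp a (dirac k 1%g))).

Definition comp_p psi (a : {ffun gT -> k^o}) : {ffun hT -> k^o} :=
  ev1_id (psi (dsharp a (dirac k 1%g))).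

Definition comp_r psi (x : {ffun gT -> k^o}) : {ffun hT -> k^o} :=
  id_counit (psi (dsharp [ffun => 1] x)).

Definition comp_v psi (x : {ffun gT -> k^o}) : {ffun hT -> k^o} :=
  ev1_id (psi (dsharp [ffun => 1] x)).

End Morphisms.

Definition is_flip (k : fieldType) (gT hT : finGroupType)
    (psi : 'Hom(drinfeld k gT, drinfeld k hT))
    (phi : 'Hom(drinfeld k hT, drinfeld k gT)) : Prop :=
  hopf_morphism phi /\
  [/\ comp_p phi =1 transpose (comp_p psi),
      comp_u phi =1 transpose (comp_v psi),
      comp_r phi =1 transpose (comp_r psi) &
      comp_v phi =1 transpose (comp_u psi)].

Definition flippable (k : fieldType) (gT hT : finGroupType)
    (psi : 'Hom(drinfeld k gT, drinfeld k hT)) : Prop :=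
  exists phi, is_flip psi phi.

Section Automorphisms.
Variables (k : fieldType) (gT : finGroupType).
Local Notation D := (drinfeld k gT).

Definition is_hopf_aut (f : 'End(D)) : Prop := hopf_morphism f /\ bijective f.

Record hopf_aut : Type := HopfAut {
  hopf_aut_val :> 'End(D);
  hopf_aut_subproof : `[< is_hopf_aut hopf_aut_val >]
}.

HB.instance Definition _ := [isSub for hopf_aut_val].
HB.instance Definition _ := [Choice of hopf_aut by <:].

Lemma hopf_autP (f : hopf_aut) : is_hopf_aut f.
Proof. exact/asboolP/hopf_aut_subproof. Qed.

Lemma dotimes_linearl (y : D) : linear (fun x : D => dotimes x y).
Proof.
move=> l x x'; apply/ffunP=> s; rewrite !ffunE /= dcoefD dcoefZ mulrDl -mulrA.
by [].
Qed.

Lemma dotimes_linearr (x : D) : linear (dotimes x).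
Proof.
move=> l y y'; apply/ffunP=> s; rewrite !ffunE /= dcoefD dcoefZ mulrDr mulrCA.
by [].
Qed.

Lemma dtensor_map_linear (f : 'End(D)) : linear (dtensor_map f).
Proof.
move=> l t t'; rewrite /dtensor_map scaler_sumr -big_split /=.
by apply: eq_bigr => s _; rewrite !ffunE scalerDl scalerA.
Qed.

Lemma dtensor_map_otimes (f : 'End(D)) (x y : D) :
  dtensor_map f (dotimes x y) = dotimes (f x) (f y).
Proof.
pose Ll y := GRing.isLinear.Build _ _ _ _ _ (@dotimes_linearl y).
pose Lr x := GRing.isLinear.Build _ _ _ _ _ (@dotimes_linearr x).
pose L y : {linear D -> dtensor k gT} :=
  HB.pack (fun x : D => dotimes x y) (Ll y).
pose R x : {linear D -> dtensor k gT} := HB.pack (dotimes x) (Lr x).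
rewrite {2}(dbase_sum x) {2}(dbase_sum y) !linear_sum.
rewrite -[RHS]/(L _ _) linear_sum /dtensor_map.
transitivity (\sum_(s : gT * gT) \sum_(t : gT * gT) (dotimes x y) (s, t) *:
    dotimes (f (dbase k s.1 s.2)) (f (dbase k t.1 t.2))).
  by rewrite pair_bigA; apply: eq_bigr => -[].
apply: eq_bigr => s _; rewrite -[RHS]/(R _ _) linear_sum; apply: eq_bigr => t _.
rewrite !linearZ /= -[dotimes _ _ in RHS]/(L _ _) linearZ /= scalerA mulrC.
by rewrite ffunE.
Qed.

Lemma dtensor_map_comp (f g : 'End(D)) t :
  dtensor_map (f \o g)%VF t = dtensor_map f (dtensor_map g t).
Proof.
pose Lf := GRing.isLinear.Build _ _ _ _ _ (@dtensor_map_linear f).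
pose L : {linear dtensor k gT -> dtensor k gT} := HB.pack (dtensor_map f) Lf.
rewrite -[RHS]/(L _) {2}/dtensor_map linear_sum; apply: eq_bigr => s _.
by rewrite linearZ /= dtensor_map_otimes !comp_lfunE.
Qed.

Lemma is_hopf_aut_comp (f g : 'End(D)) :
  is_hopf_aut f -> is_hopf_aut g -> is_hopf_aut (f \o g)%VF.
Proof.
case=> [[[f1 fM] fD fe fS] bf] [[[g1 gM] gD ge gS] bg]; split; last first.
  by apply: (eq_bij (bij_comp bf bg)) => x; rewrite comp_lfunE.
split=> [|x|x|x]; rewrite ?comp_lfunE.
- by split=> [|x y]; rewrite !comp_lfunE ?g1 ?f1 ?gM ?fM.
- by rewrite fD gD dtensor_map_comp.
- by rewrite fe ge.
- by rewrite fS gS.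
Qed.

Lemma dtensor_map_id (t : dtensor k gT) : dtensor_map \1%VF t = t.
Proof.
apply/ffunP=> -[[a b] [c d]]; rewrite sum_ffunE (bigD1 ((a, b), (c, d))) //=.
rewrite big1 ?addr0 => [|[[a' b'] [c' d']]];
  rewrite !ffunE /= !id_lfunE !mkdrinfeldE.
  by rewrite !eqxx mulr1 [_ *: _]mulr1.
rewrite eq_sym !xpair_eqE -natrM mulnb => /negPf->.
by rewrite [_ *: _]mulr0.
Qed.

Lemma is_hopf_aut_id : is_hopf_aut \1%VF.
Proof.
split; last by exists id => x; rewrite id_lfunE.
split=> [|x|x|x]; rewrite ?id_lfunE ?dtensor_map_id //.
by split=> [|x y]; rewrite !id_lfunE.
Qed.

Lemma is_hopf_aut_ker (f : 'End(D)) : is_hopf_aut f -> lker f == 0%VS.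
Proof. by case=> _ /bij_inj fI; apply/lker0P. Qed.

Lemma is_hopf_aut_inv (f : 'End(D)) :
  is_hopf_aut f -> is_hopf_aut (f^-1)%VF.
Proof.
move=> af; have kf := is_hopf_aut_ker af.
have fK := lker0_lfunK kf; have Kf := lker0_lfunVK kf; have fI := can_inj fK.
case: af => [[[f1 fM] fD fe fS] bf]; split; last by exists f.
split=> [|x|x|x].
- by split=> [|x y]; apply: fI; rewrite ?fM !Kf // f1.
- rewrite -{2}(Kf x) fD -dtensor_map_comp lker0_compVf //.
  by rewrite dtensor_map_id.
- by rewrite -fe Kf.
- by apply: fI; rewrite -fS !Kf.
Qed.

Definition hopf_aut_mul (f g : hopf_aut) : hopf_aut :=
  HopfAut (introT (asboolP _)
    (is_hopf_aut_comp (hopf_autP f) (hopf_autP g))).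

Definition hopf_aut_one : hopf_aut :=
  HopfAut (introT (asboolP _) is_hopf_aut_id).

Definition hopf_aut_inv (f : hopf_aut) : hopf_aut :=
  HopfAut (introT (asboolP _) (is_hopf_aut_inv (hopf_autP f))).

Lemma hopf_aut_mulA : associative hopf_aut_mul.
Proof. by move=> f g h; apply: val_inj; rewrite /= comp_lfunA. Qed.

Lemma hopf_aut_mul1 : left_id hopf_aut_one hopf_aut_mul.
Proof. by move=> f; apply: val_inj; rewrite /= comp_lfun1l. Qed.

Lemma hopf_aut_mulx1 : right_id hopf_aut_one hopf_aut_mul.
Proof. by move=> f; apply: val_inj; rewrite /= comp_lfun1r. Qed.

Lemma hopf_aut_mulV : left_inverse hopf_aut_one hopf_aut_inv hopf_aut_mul.
Proof.
move=> f; apply: val_inj; rewrite /= lker0_compVf //.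
exact/is_hopf_aut_ker/hopf_autP.
Qed.

Lemma hopf_aut_mulxV : right_inverse hopf_aut_one hopf_aut_inv hopf_aut_mul.
Proof.
move=> f; apply: val_inj; rewrite /= lker0_compfV //.
exact/is_hopf_aut_ker/hopf_autP.
Qed.

HB.instance Definition _ := isGroup.Build hopf_aut
  hopf_aut_mulA hopf_aut_mul1 hopf_aut_mulx1 hopf_aut_mulV hopf_aut_mulxV.

End Automorphisms.

(* Main.v *)
(* Let c g h x y be the coefficient of e_x # y in psi (e_g # h). By the formula
   psi (a # g) = u(a_(1)) r(g) # p(a_(2)) v(g), the flip of psi can only be the
   linear map with coefficients (y, x; h, g) |-> c g h x y, that is the
   transpose of psi conjugated by the exchange of the two tensor factors. Hence
   flipping is involutive and reverses compositions, and the point is that this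
   transpose is a Hopf algebra morphism when psi is bijective.
     Multiplicativity and comultiplicativity show that the image of p^* commutes
   with itself and with the image of u^*, hence with all of kG as psi is
   injective; dually, surjectivity makes the image of p central. Since p and p^*
   are morphisms of algebras, P a b := p(e_a)(b) vanishes unless a and b are
   both central. Then u is multiplicative, so that u^* and v are homomorphisms
   w, v : G -> G, and c g h x y = r(h)(x) P (g w(x)^-1) (y v(h)^-1).
     Compatibility with the product gives w(x^v(h)) = w(x)^h. As G = Z(G) w(G)
   = Z(G) v(G), the symmetric relation v(h^w(x)) = v(h)^x follows. These two
   relations turn the multiplicativity of psi into the comultiplicativity of its
   flip, and conversely. *)

From HB Require Import structures.
Require Import Defs.
From mathcomp Require Import all_boot all_algebra all_fingroup.
From mathcomp Require Import boolp.

Set Implicit Arguments.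
Unset Strict Implicit.
Unset Printing Implicit Defensive.

Import GRing.Theory.
Local Open Scope ring_scope.

(** * Hopf morphisms in matrix coefficients *)

Section Coefficients.
Variables (k : fieldType) (gT : finGroupType).
Local Notation D := (drinfeld k gT).
Implicit Types (psi phi : 'End(D)) (g h x y a b z : gT).

Definition coef psi g h x y : k := dcoef (psi (dbase k g h)) x y.

(** The axioms are stated for an arbitrary array [c], so that the reindexed array of the flip can be
    tested against them. The boolean factors record when a product of two basis vectors is nonzero
    and that group elements are group-like. *)
Record hopf_coef (c : gT -> gT -> gT -> gT -> k) : Prop := HopfCoef {
  hopf_coefM : forall g h g' h' x y,
    (g == h * g' * h^-1)%g%:R * c g (h * h')%g x y =
      \sum_z c g h x z * c g' h' (x ^ z)%g (z^-1 * y)%g;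
  hopf_coef1 : forall x y, \sum_g c g 1%g x y = (y == 1%g)%:R;
  hopf_coef_comul : forall g h x y x' y',
    (y == y')%:R * c g h (x' * x)%g y =
      \sum_a c (a^-1 * g)%g h x y * c a h x' y';
  hopf_coef_counit : forall g h, \sum_y c g h 1%g y = (g == 1%g)%:R;
  hopf_coefS : forall g h x y,
    c (g^-1 ^ h)%g h^-1%g x y = c g h (x ^ y)^-1%g y^-1%g
}.

Lemma dcoef_sum (I : finType) (F : I -> D) x y :
  dcoef (\sum_i F i) x y = \sum_i dcoef (F i) x y.
Proof. by rewrite /dcoef sum_ffunE. Qed.

Lemma dcoef_dbase g h x y :
  dcoef (dbase k g h) x y = ((x == g) && (y == h))%:R.
Proof. by rewrite mkdrinfeldE. Qed.

Lemma done_sum : 1 = \sum_g dbase k g 1%g :> D.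
Proof.
apply: drinfeldP => x y; rewrite dcoef_sum mkdrinfeldE (bigD1 x) //=.
rewrite big1 ?addr0 ?dcoef_dbase ?eqxx // => a /negPf na.
by rewrite dcoef_dbase eq_sym na.
Qed.

Lemma dcoef_lfun psi (z : D) x y :
  dcoef (psi z) x y = \sum_s dcoef z s.1 s.2 * coef psi s.1 s.2 x y.
Proof.
rewrite {1}(dbase_sum z) linear_sum dcoef_sum; apply: eq_bigr => s _.
by rewrite linearZ dcoefZ.
Qed.

Lemma sum_delta (I : finType) (i : I) (F : I -> k) :
  \sum_j (j == i)%:R * F j = F i.
Proof.
rewrite (bigD1 i) //= eqxx mul1r big1 ?addr0 // => j /negPf nj.
by rewrite nj mul0r.
Qed.

Lemma sum_delta_eq (I : finType) (i : I) (F : I -> k) :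
  \sum_j (i == j)%:R * F j = F i.
Proof. by under eq_bigr => j _ do rewrite eq_sym; apply: sum_delta. Qed.

Lemma sum_delta1 (I : finType) (i : I) : \sum_j (j == i)%:R = 1 :> k.
Proof.
by rewrite -[RHS](sum_delta i (fun=> 1)); apply: eq_bigr => j _; rewrite mulr1.
Qed.

Lemma sum_dbase g h (F : gT * gT -> k) :
  \sum_s dcoef (dbase k g h) s.1 s.2 * F s = F (g, h).
Proof.
rewrite -[RHS](sum_delta (g, h)); apply: eq_bigr => -[a b] _.
by rewrite dcoef_dbase xpair_eqE.
Qed.

Lemma lfun_eq_coef psi phi : (forall g h x y, coef psi g h x y = coef phi g h x y)
  -> psi = phi.
Proof.
move=> e; apply/lfunP => z; apply: drinfeldP => x y; rewrite !dcoef_lfun.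
by apply: eq_bigr => s _; rewrite e.
Qed.

(** Only the summand with [a = x'] and k^G index [x' * x] contributes; the order of this product
    reflects the exchanged factors in the coalgebra of k^G. *)
Lemma dcomulE (z : D) x y x' y' :
  dcomul z ((x, y), (x', y')) = (y == y')%:R * dcoef z (x' * x)%g y.
Proof.
rewrite sum_ffunE -[RHS](sum_delta (x' * x, y)%g
  (fun s => (y == y')%:R * dcoef z s.1 s.2)).
apply: eq_bigr => -[g h] _; rewrite ffunE sum_ffunE /=.
under eq_bigr => a _ do rewrite ffunE !dcoef_dbase /=.
rewrite (bigD1 x') //= big1 ?addr0; last first.
  by move=> a /negPf na; rewrite [x' == a]eq_sym na /= mulr0.
rewrite eqxx /= (_ : (x == x'^-1 * g)%g = (g == x' * x)%g); last first.
  by rewrite -(inj_eq (mulgI x')) mulKVg eq_sym.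
rewrite xpair_eqE -[LHS]/(_ * _) [h == y]eq_sym [y' == h]eq_sym.
case: (g == _); case: (eqVneq y h) => [->|]; rewrite /= ?mul0r ?mulr0 ?mul1r //.
by rewrite mulrC eq_sym.
Qed.

Lemma dtensor_map_coef psi (t : dtensor k gT) x y x' y' :
  dtensor_map psi t ((x, y), (x', y')) =
    \sum_s (t : {ffun _ -> k^o}) s *
      (coef psi s.1.1 s.1.2 x y * coef psi s.2.1 s.2.2 x' y').
Proof. by rewrite sum_ffunE; apply: eq_bigr => s _; rewrite !ffunE. Qed.

Lemma dantipodeE (z : D) x y :
  dcoef (dantipode z) x y = dcoef z (x ^ y)^-1%g y^-1%g.
Proof.
rewrite dcoef_sum -[RHS](sum_delta ((x ^ y)^-1, y^-1)%g
  (fun s => dcoef z s.1 s.2)); apply: eq_bigr => -[g h] _ /=.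
rewrite dcoefZ dcoef_dbase mulrC xpair_eqE; congr ((nat_of_bool _)%:R * _).
rewrite [y == _]eq_sym (inv_eq invgK h y) andbC [RHS]andbC.
case: eqVneq => //= ->; rewrite eq_sym -(inj_eq (conjg_inj y)) conjgKV.
by rewrite (inv_eq invgK).
Qed.

Lemma dtensor_map_dcomul psi (z : D) x y x' y' :
  dtensor_map psi (dcomul z) ((x, y), (x', y')) =
    \sum_s dcoef z s.1 s.2 *
      \sum_a coef psi (a^-1 * s.1)%g s.2 x y * coef psi a s.2 x' y'.
Proof.
pose F g h g' h' := (h == h')%:R * dcoef z (g' * g)%g h *
  (coef psi g h x y * coef psi g' h' x' y').
transitivity (\sum_g \sum_h \sum_g' \sum_h' F g h g' h').
  rewrite dtensor_map_coef pair_bigA.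
  under [RHS]eq_bigr => p _ do rewrite pair_bigA.
  rewrite pair_bigA; apply: eq_bigr => -[[g h] [g' h']] _ /=.
  by rewrite dcomulE.
under [RHS]eq_bigr => s _ do rewrite mulr_sumr.
rewrite [RHS]exchange_big /=.
under eq_bigr => g _.
  under eq_bigr => h _.
    under eq_bigr => g' _.
      rewrite /F; under eq_bigr => h' _ do rewrite -mulrA.
      rewrite sum_delta_eq; over.
    over.
  rewrite exchange_big; over.
rewrite exchange_big; apply: eq_bigr => a _ /=.
(* Replacing the first k^G index by [a^-1 * g] turns the index of [z] into [g]. *)
rewrite (reindex_inj (mulgI a^-1)%g) /= pair_bigA.
by apply: eq_bigr => -[g h] _ /=; rewrite mulKVg.
Qed.

Lemma coef_mul psi g h g' h' x y :
  dcoef (psi (dbase k g h) * psi (dbase k g' h')) x y =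
    \sum_z coef psi g h x z * coef psi g' h' (x ^ z)%g (z^-1 * y)%g.
Proof. by rewrite mkdrinfeldE. Qed.

(** The axioms are linear or bilinear in the elements of D(G), hence can be tested on the basis; the
    unit is the sum of the e_g # 1. *)
Lemma hopf_morphismP psi : hopf_morphism psi <-> hopf_coef (coef psi).
Proof.
split=> [[[f1 fM] fD fe fS]|[cM c1 cD ce cS]].
  split=> [g h g' h' x y|x y|g h x y x' y'|g h|g h x y].
  - rewrite -coef_mul -fM dbaseM; case: eqP => _; rewrite ?mul1r //.
    by rewrite mul0r linear0 /dcoef ffunE.
  - transitivity (dcoef (psi 1) x y); last by rewrite f1 mkdrinfeldE.
    by rewrite done_sum linear_sum dcoef_sum.
  - by rewrite -dcomulE fD dtensor_map_dcomul sum_dbase.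
  - rewrite -[LHS]/(dcounit _) fe /dcounit (bigD1 h) //= big1 ?addr0.
      by rewrite dcoef_dbase eqxx andbT eq_sym.
    by move=> b /negPf nb; rewrite dcoef_dbase nb andbF.
  - transitivity (dcoef (dantipode (psi (dbase k g h))) x y); last first.
      by rewrite dantipodeE.
    rewrite fS; congr dcoef; congr (psi _).
    apply: drinfeldP => a b; rewrite dantipodeE !dcoef_dbase.
    congr (nat_of_bool _)%:R; rewrite (inv_eq invgK b h) andbC [RHS]andbC.
    case: eqVneq => //= ->; rewrite (inv_eq invgK).
    by rewrite -[RHS](inj_eq (conjg_inj h)) conjgKV.
split=> [|z|z|z].
- split=> [|X Y].
    apply: drinfeldP => x y.
    by rewrite [RHS]mkdrinfeldE -(c1 x) done_sum linear_sum dcoef_sum.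
  rewrite {1}(dbase_sum X) {2}(dbase_sum X) !linear_sum !mulr_suml linear_sum.
  apply: eq_bigr => s _.
  rewrite {1}(dbase_sum Y) {2}(dbase_sum Y) !linear_sum !mulr_sumr linear_sum.
  apply: eq_bigr => t _.
  rewrite !linearZ /= -!scalerAl !linearZ /= -!scalerAr !linearZ /=.
  congr (_ *: (_ *: _)); apply: drinfeldP => x y; rewrite coef_mul -cM dbaseM.
  by case: eqP => _; rewrite ?mul1r // mul0r linear0 /dcoef ffunE.
- apply/ffunP => -[[x y] [x' y']].
  rewrite dtensor_map_dcomul dcomulE dcoef_lfun.
  by rewrite mulr_sumr; apply: eq_bigr => s _; rewrite mulrCA cD.
- rewrite /dcounit; under eq_bigr => h _ do rewrite dcoef_lfun.
  rewrite exchange_big; under eq_bigr => s _ do rewrite -mulr_sumr ce.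
  rewrite -(pair_bigA _ (fun a b => dcoef z a b * (a == 1%g)%:R)) exchange_big.
  apply: eq_bigr => h _ /=; rewrite -(sum_delta 1%g (fun g => dcoef z g h)).
  by apply: eq_bigr => g _; rewrite mulrC.
- apply: drinfeldP => x y; rewrite dantipodeE !dcoef_lfun.
  (* The antipode permutes the basis, and this is its permutation. *)
  rewrite [RHS](reindex_inj (h := fun s : gT * gT => (s.1^-1 ^ s.2, s.2^-1)%g)).
    apply: eq_bigr => -[g h] _ /=; rewrite dantipodeE cS.
    by rewrite conjgK !invgK.
  move=> [a b] [a' b'] [/= + /invg_inj eb]; rewrite -eb.
  by move=> /conjg_inj/invg_inj ->.
Qed.
End Coefficients.

(** * The components p, u, r, v of a Hopf morphism *)

Section Components.
Variables (k : fieldType) (gT : finGroupType) (c : gT -> gT -> gT -> gT -> k).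
Implicit Types g h x y a b z : gT.

(* The matrices of p, u^*, r and v: compP a b is the coefficient of b in p(e_a),
   and compU g x is u(e_g)(x). *)
Definition compP a b : k := c a 1%g 1%g b.
Definition compU g x : k := \sum_y c g 1%g x y.
Definition compR h x : k := \sum_g \sum_y c g h x y.
Definition compV h y : k := \sum_g c g h 1%g y.

Hypothesis hopf_c : hopf_coef c.
Let cM := hopf_coefM hopf_c.
Let c1 := hopf_coef1 hopf_c.
Let cD := hopf_coef_comul hopf_c.
Let ce := hopf_coef_counit hopf_c.
Local Notation E g h x := (\sum_y c g h x y).

(** Comultiplicativity, with the counit applied to the kG leg of the first tensor factor and ev_1 to
    the k^G leg of the second. *)
Lemma coef_split g h x y : c g h x y = \sum_a E (a^-1 * g)%g h x * c a h 1%g y.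
Proof.
under eq_bigr => a _ do rewrite mulr_suml.
rewrite exchange_big; under eq_bigr => z _ do rewrite -cD mul1g.
by rewrite sum_delta.
Qed.

Lemma coef_split_op g h x y :
  c g h x y = \sum_a c (a^-1 * g)%g h 1%g y * E a h x.
Proof.
under eq_bigr => a _ do rewrite mulr_sumr.
rewrite exchange_big; under eq_bigr => z _ do rewrite -cD mulg1.
by rewrite sum_delta_eq.
Qed.

Lemma eq_conjg g g' h : (g' == g ^ h)%g = (g == h * g' * h^-1)%g.
Proof.
by rewrite -(inj_eq (conjg_inj h^-1)%g) conjgK conjgE invgK mulgA eq_sym.
Qed.

(** Conjugation fixes 1, so ev_1 ⊗ id respects products. *)
Lemma coef_kG_mul g h g' h' y :
  (g == h * g' * h^-1)%g%:R * c g (h * h')%g 1%g y =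
    \sum_z c g h 1%g z * c g' h' 1%g (z^-1 * y)%g.
Proof. by rewrite cM; apply: eq_bigr => z _; rewrite conj1g. Qed.

(** Write e_g # h as (e_g # 1)(ε # h) and expand ε # h as the sum of the e_a # h, of which only
    [a = g] survives. *)
Lemma coef_kG_PV g h y :
  c g h 1%g y = \sum_z compP g z * compV h (z^-1 * y)%g.
Proof.
under eq_bigr => z _ do rewrite mulr_sumr.
rewrite exchange_big -[LHS](sum_delta_eq g (fun=> c g h 1%g y)).
apply: eq_bigr => a _.
by have := coef_kG_mul g 1%g a h y; rewrite mul1g invg1 !mul1g mulg1.
Qed.

Lemma compV_sum h : \sum_y compV h y = 1.
Proof.
rewrite exchange_big; under eq_bigr => g _ do rewrite ce.
exact: sum_delta1.
Qed.

(** This says that v(h) is group-like in kG; it is comultiplicativity at [x = x' = 1], summed over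
    [g]. *)
Lemma compV_idem h y y' : compV h y * compV h y' = (y == y')%:R * compV h y.
Proof.
rewrite [RHS]mulr_sumr.
have cD1 g : (y == y')%:R * c g h 1%g y =
    \sum_a c (a^-1 * g)%g h 1%g y * c a h 1%g y' by rewrite -cD mulg1.
under [RHS]eq_bigr => g _ do rewrite cD1.
rewrite exchange_big [LHS]mulr_sumr; apply: eq_bigr => a _ /=.
by rewrite -mulr_suml [in RHS](reindex_inj (mulgI a)%g) /=;
  under [in RHS]eq_bigr => g _ do rewrite mulKg.
Qed.

Lemma compV_mul h h' y :
  compV (h * h')%g y = \sum_z compV h z * compV h' (z^-1 * y)%g.
Proof.
under eq_bigr => z _ do rewrite big_distrlr.
rewrite exchange_big; apply: eq_bigr => g _; rewrite exchange_big /=.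
rewrite -[LHS](sum_delta (g ^ h)%g (fun=> c g (h * h')%g 1%g y)).
apply: eq_bigr => g' _; by rewrite -coef_kG_mul eq_conjg.
Qed.

(** Summing comultiplicativity over [g], [y] and [y'] decouples the two factors: r(h) is group-like
    in k^G, that is, a linear character. *)
Lemma compR_comul h x x' : compR h (x' * x)%g = compR h x * compR h x'.
Proof.
rewrite mulr_sumr /compR; under eq_bigr => g _.
  under eq_bigr => y _.
    rewrite -(sum_delta_eq y (fun=> c g h (x' * x)%g y)).
    under eq_bigr => y' _ do rewrite cD.
    rewrite exchange_big /=; under eq_bigr => a _ do rewrite -mulr_sumr.
    over.
  rewrite exchange_big /=; under eq_bigr => a _ do rewrite -mulr_suml.
  over.
rewrite exchange_big; apply: eq_bigr => a _ /=.
by rewrite -mulr_suml [in RHS](reindex_inj (mulgI a^-1)%g).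
Qed.

Lemma compR1r h : compR h 1%g = 1.
Proof.
rewrite /compR; under eq_bigr => g _ do rewrite ce.
exact: sum_delta1.
Qed.

Lemma compR1l x : compR 1%g x = 1.
Proof.
rewrite /compR exchange_big; under eq_bigr => y _ do rewrite c1.
exact: sum_delta1.
Qed.

Lemma compRJ h x z : compR h (x ^ z)%g = compR h x.
Proof.
rewrite conjgE !compR_comul (mulrC (compR h z)) -mulrA -compR_comul mulVg.
by rewrite compR1r mulr1.
Qed.

Lemma coef_counit_mul g h g' h' x :
  (g == h * g' * h^-1)%g%:R * E g (h * h')%g x =
    \sum_z c g h x z * E g' h' (x ^ z)%g.
Proof.
rewrite mulr_sumr; under eq_bigr => y _ do rewrite cM.
rewrite exchange_big; apply: eq_bigr => z _ /=.
by rewrite -mulr_sumr [in RHS](reindex_inj (mulgI z^-1)%g).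
Qed.

Lemma compR_mul h h' x : compR (h * h')%g x = compR h x * compR h' x.
Proof.
transitivity (\sum_g \sum_z c g h x z * compR h' (x ^ z)%g).
  apply: eq_bigr => g _.
  under [RHS]eq_bigr => z _ do rewrite mulr_sumr.
  rewrite exchange_big -[LHS](sum_delta (g ^ h)%g (fun=> E g (h * h')%g x)).
  by apply: eq_bigr => g' _; rewrite -coef_counit_mul eq_conjg.
rewrite [in RHS]mulr_suml; apply: eq_bigr => g _; rewrite mulr_suml.
by apply: eq_bigr => z _; rewrite compRJ.
Qed.

(** Again e_g # h = (e_g # 1)(ε # h); the twist by [z] in the product is invisible to r(h), which is
    a class function. *)
Lemma coef_counit_UR g h x : E g h x = compU g x * compR h x.
Proof.
rewrite -[LHS](sum_delta_eq g (fun=> E g h x)) mulr_sumr.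
under eq_bigr => a _.
  have := coef_counit_mul g 1%g a h x; rewrite mul1g invg1 mul1g mulg1 => ->.
  over.
rewrite -[RHS]mulr_sumr exchange_big mulr_suml; apply: eq_bigr => z _ /=.
by rewrite -mulr_sumr -[X in _ * X = _]/(compR h _) compRJ.
Qed.

(** The formula psi(a # g) = u(a_(1)) r(g) # p(a_(2)) v(g) in coefficients. *)
Lemma coef_components g h x y : c g h x y =
  \sum_a compU (a^-1 * g)%g x * compR h x *
    \sum_z compP a z * compV h (z^-1 * y)%g.
Proof.
rewrite coef_split; apply: eq_bigr => a _.
by rewrite coef_counit_UR coef_kG_PV.
Qed.

Lemma compU_sum x : \sum_g compU g x = 1.
Proof.
rewrite exchange_big; under eq_bigr => y _ do rewrite c1.
exact: sum_delta1.
Qed.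

Lemma compU_comul g x x' :
  compU g (x' * x)%g = \sum_a compU (a^-1 * g)%g x * compU a x'.
Proof.
under [RHS]eq_bigr => a _ do rewrite mulr_suml.
rewrite exchange_big; apply: eq_bigr => y _ /=.
rewrite -[LHS](sum_delta_eq y (fun=> c g 1%g (x' * x)%g y)).
under [RHS]eq_bigr => a _ do rewrite mulr_sumr.
by rewrite [RHS]exchange_big; apply: eq_bigr => y' _; rewrite -cD.
Qed.

(** Two evaluations at [x] of id ⊗ counit on the image of (ε # h)(e_g # 1) = e_{hgh^-1} # h; the
    right side uses that ε # h is sent to r(h) # v(h). *)
Lemma compU_act g h x :
  compU (h * g * h^-1)%g x * compR h x =
    compR h x * \sum_z compV h z * compU g (x ^ z)%g.
Proof.
rewrite -coef_counit_UR -[LHS](sum_delta (h * g * h^-1)%g (fun a => E a h x)).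
transitivity (\sum_a \sum_z c a h x z * compU g (x ^ z)%g).
  by apply: eq_bigr => a _; rewrite -coef_counit_mul mulg1.
rewrite exchange_big mulr_sumr; apply: eq_bigr => z _ /=.
rewrite -mulr_suml mulrA; congr (_ * _).
under eq_bigr => a _ do rewrite coef_split_op.
rewrite exchange_big [compR h x * _]mulrC.
rewrite mulr_sumr; apply: eq_bigr => a _ /=; rewrite -mulr_suml.
by congr (_ * _); rewrite [RHS](reindex_inj (mulgI a^-1)%g).
Qed.

End Components.

(** * Central functions, idempotents and the rigid form of coefficients *)

Section Rigidity.
Variables (k : fieldType) (gT : finGroupType).
Implicit Types g h x y a b z : gT.

Lemma morphVg (f : gT -> gT) : {morph f : x y / (x * y)%g} ->
  {morph f : x / x^-1%g}.
Proof.
move=> fM x; apply: (mulgI (f x)); rewrite -fM !mulgV.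
by apply: (mulgI (f 1%g)); rewrite -fM !mulg1.
Qed.

Lemma morphJg (f : gT -> gT) : {morph f : x y / (x * y)%g} ->
  {morph f : x y / (x ^ y)%g}.
Proof. by move=> fM x y; rewrite !conjgE !fM morphVg. Qed.

Lemma conj_central x z : (forall t, z ^ t = z)%g -> (x ^ z = x)%g.
Proof. by move=> cz; rewrite conjgE -{2}(cz x) conjgE mulKVg mulKg. Qed.

(** Under convolution [f] commutes with a spanning family, hence with the delta function at [z],
    which amounts to invariance under conjugation by [z]. *)
Lemma conj_invariant_of_span (I : finType) (F : I -> gT -> k) (f : gT -> k) :
    (forall i g, \sum_a F i (a^-1 * g)%g * f a =
                 \sum_a f (a^-1 * g)%g * F i a) ->
    (forall z, exists n : I -> k,
       forall g, \sum_i n i * F i g = (g == z)%:R) ->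
  forall g z, f (g ^ z)%g = f g.
Proof.
move=> Ff span g z; have [n dz] := span z.
pose d a : k := (a == z)%:R.
have dE a : d a = \sum_i n i * F i a by rewrite dz.
have comm t : \sum_a d (a^-1 * t)%g * f a = \sum_a f (a^-1 * t)%g * d a.
  under eq_bigr => a _ do rewrite dE mulr_suml.
  under [RHS]eq_bigr => a _ do rewrite dE mulr_sumr.
  rewrite exchange_big [RHS]exchange_big; apply: eq_bigr => i _ /=.
  under eq_bigr => a _ do rewrite -mulrA.
  under [RHS]eq_bigr => a _ do rewrite mulrCA.
  by rewrite -!mulr_sumr Ff.
have := comm (g * z)%g; rewrite /d.
under [X in _ = X]eq_bigr => a _ do rewrite mulrC.
rewrite sum_delta conjgE => <-.
rewrite -[RHS](sum_delta g f); apply: eq_bigr => a _.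
congr ((nat_of_bool _)%:R * _).
by rewrite -(inj_eq (mulgI a)) mulKVg (inj_eq (mulIg z)) eq_sym.
Qed.

Lemma conj_invariantC (f : gT -> k) a b :
  (forall g z, f (g ^ z)%g = f g) -> f (a * b)%g = f (b * a)%g.
Proof. by move=> fJ; rewrite -(fJ _ a) conjgE mulgA mulKg. Qed.

(** Two distinct values cannot both be nonzero in a field, and a nonzero idempotent is 1. This turns
    group-like elements of kG, and characters of k^G, into elements of the group. *)
Lemma orthogonal_idempotents_delta (I : finType) (f : I -> k) :
    (forall i j, f i * f j = (i == j)%:R * f i) -> \sum_i f i = 1 ->
  exists i, forall j, f j = (j == i)%:R.
Proof.
move=> ff f1; have [i fi0|f0] := pickP (fun i => f i != 0); last first.
  move/eqP: f1; rewrite big1 ?(eq_sym 0) ?oner_eq0 // => i _.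
  by apply/eqP; have := f0 i; case: eqP.
exists i => j; have := ff j i; case: eqVneq => [->|_].
  by rewrite mul1r -[RHS in _ = RHS]mulr1 => /(mulfI fi0).
by rewrite mul0r => /eqP; rewrite mulf_eq0 (negPf fi0) orbF => /eqP.
Qed.

(* With [c] the coefficients of psi, [w] is the group homomorphism dual to u,
   and [P], [R], [v] are the matrices of p, r, v. *)
Record aut_shape (c : gT -> gT -> gT -> gT -> k)
    (P R : gT -> gT -> k) (v w : gT -> gT) : Prop := AutShape {
  shapeE : forall g h x y,
    c g h x y = R h x * P (g * (w x)^-1)%g (y * (v h)^-1)%g;
  shape_centl : forall a b, P a b != 0 -> forall z, (a ^ z = a)%g;
  shape_centr : forall a b, P a b != 0 -> forall z, (b ^ z = b)%g;
  shapeV : forall a b, P a^-1%g b^-1%g = P a b;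
  shapeRl : forall h h' x, R (h * h')%g x = R h x * R h' x;
  shapeRr : forall h x x', R h (x * x')%g = R h x * R h x';
  shapeR1l : forall x, R 1%g x = 1;
  shapeR1r : forall h, R h 1%g = 1;
  shapev : {morph v : h h' / (h * h')%g};
  shapew : {morph w : x x' / (x * x')%g};
  shapewJ : forall x h, w (x ^ v h)%g = (w x ^ h)%g;
  shapevJ : forall h x, v (h ^ w x)%g = (v h ^ x)%g
}.

(** * The shape of the coefficients of an automorphism *)

Section Shape.
Variable c : gT -> gT -> gT -> gT -> k.
Hypothesis hopf_c : hopf_coef c.
(** The traces of bijectivity that are used: [span_source] comes from a left inverse on k^G # 1, and
    [span_target] from a right inverse followed by ev_1 ⊗ id. *)
Hypothesis span_source : forall z, exists n : gT * gT -> k,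
  forall g, \sum_s n s * c g 1%g s.1 s.2 = (g == z)%:R.
Hypothesis span_target : forall z, exists n : gT * gT -> k,
  forall y, \sum_s n s * c s.1 s.2 1%g y = (y == z)%:R.
Let cD := hopf_coef_comul hopf_c.
Local Notation P := (compP c).
Local Notation U := (compU c).
Local Notation R := (compR c).
Local Notation V := (compV c).

(** Both convolutions with [c _ 1 x y] are given by comultiplicativity, with 1 in one of the two k^G
    slots, and [x * 1 = 1 * x]. *)
Lemma compP_classl a b z : P (a ^ z)%g b = P a b.
Proof.
move: a z; apply: (conj_invariant_of_span (f := P ^~ b)
  (F := fun s g => c g 1%g s.1 s.2)) span_source => -[x y] g /=.
rewrite -!cD mulg1 mul1g [b == y]eq_sym.
by case: eqVneq => [->|]; rewrite ?mul0r.
Qed.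

(** In D(G), (e_a # 1)(e_g # h) = (e_g # h)(e_{a^h} # 1), and [compP_classl] replaces [a ^ h] by
    [a]. *)
Lemma compP_classr a b z : P a (b ^ z)%g = P a b.
Proof.
move: b z; apply: (conj_invariant_of_span (f := P a)
  (F := fun s y => c s.1 s.2 1%g y)) span_target => -[g h] y /=.
transitivity ((a == g)%:R * c a h 1%g y).
  have := coef_kG_mul hopf_c a 1 g h y; rewrite mul1g invg1 mul1g mulg1 => ->.
  by apply: eq_bigr => z _; rewrite mulrC.
transitivity (\sum_z c g h 1%g z * P (a ^ h)%g (z^-1 * y)%g); last first.
  by apply: eq_bigr => z _; rewrite compP_classl mulrC.
rewrite -coef_kG_mul // mulg1 -eq_conjg (inj_eq (conjg_inj h)).
by case: eqVneq => [->|]; rewrite ?mul0r.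
Qed.

(** The idempotents p(e_a) and p(e_{a^z}) coincide, but are orthogonal when [a] and [a ^ z]
    differ. *)
Lemma compP_centl a b : P a b != 0 -> forall z, (a ^ z = a)%g.
Proof.
move=> Pab z; have M a' : (a == a')%:R * P a b =
    \sum_z P a z * P a' (z^-1 * b)%g.
  by have := coef_kG_mul hopf_c a 1 a' 1 b; rewrite mul1g invg1 !mulg1.
have : (a == a ^ z)%g%:R * P a b = (a == a)%:R * P a b.
  by rewrite !M; apply: eq_bigr => t _; rewrite compP_classl.
rewrite eqxx => /(mulIf Pab); case: (a =P _) => // _ /eqP.
by rewrite eq_sym oner_eq0.
Qed.

Lemma compP_centr a b : P a b != 0 -> forall z, (b ^ z = b)%g.
Proof.
move=> Pab z; have M b' : (b == b')%:R * P a b =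
    \sum_t P (t^-1 * a)%g b * P t b' by rewrite -cD mulg1.
have : (b == b ^ z)%g%:R * P a b = (b == b)%:R * P a b.
  by rewrite !M; apply: eq_bigr => t _; rewrite compP_classr.
rewrite eqxx => /(mulIf Pab); case: (b =P _) => // _ /eqP.
by rewrite eq_sym oner_eq0.
Qed.

Lemma coef_centr g x y : c g 1%g x y != 0 -> forall z, (y ^ z = y)%g.
Proof.
rewrite (coef_split hopf_c) => ne0.
have [a Pa|P0] := pickP (fun a => P a y != 0); first exact: compP_centr Pa.
case/eqP: ne0; apply: big1 => a _.
by have := P0 a; case: eqP => // Pay _; rewrite -[c _ _ _ _]/(P a y) Pay mulr0.
Qed.

(** The product twists the second factor by elements [z] with [c g 1 x z] nonzero; these are
    central, so the twist is trivial. *)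
Lemma compU_idem g g' x : U g x * U g' x = (g == g')%:R * U g x.
Proof.
have := coef_counit_mul hopf_c g 1 g' 1 x; rewrite mul1g invg1 !mulg1 => ->.
rewrite mulr_suml; apply: eq_bigr => z _.
have [->|/coef_centr cz] := eqVneq (c g 1%g x z) 0; first by rewrite !mul0r.
by rewrite conj_central.
Qed.

Lemma compP_inv a b : P a^-1%g b^-1%g = P a b.
Proof.
have := hopf_coefS hopf_c a 1%g 1%g b^-1%g.
by rewrite conjg1 invg1 conj1g invg1 invgK.
Qed.

Lemma aut_shape_components : exists v w, aut_shape c P R v w.
Proof.
have [v vE] : exists v : gT -> gT, forall h y, V h y = (y == v h)%:R.
  apply: (fin_all_exists (P := fun h u => forall y, V h y = (y == u)%:R)) => h.
  apply: orthogonal_idempotents_delta => [y y'|]; first exact: compV_idem.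
  exact: compV_sum.
have [w wE] : exists w : gT -> gT, forall x g, U g x = (g == w x)%:R.
  apply: (fin_all_exists (P := fun x u => forall g, U g x = (g == u)%:R)) => x.
  apply: orthogonal_idempotents_delta => [g g'|]; first exact: compU_idem.
  exact: compU_sum.
have oner_b (b : bool) : b%:R = 1 :> k -> b.
  by case: b => // /eqP; rewrite eq_sym oner_eq0.
have cQ g h y : c g h 1%g y = P g (y * (v h)^-1)%g.
  rewrite (coef_kG_PV hopf_c) -[RHS](sum_delta_eq _ (P g)).
  apply: eq_bigr => z _; rewrite vE mulrC; congr ((nat_of_bool _)%:R * _).
  by rewrite -(inj_eq (mulgI z)) mulKVg -[RHS](inj_eq (mulIg (v h))) mulgKV.
have cE g h x y : c g h x y = R h x * P (g * (w x)^-1)%g (y * (v h)^-1)%g.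
  rewrite (coef_split hopf_c).
  rewrite -[RHS](sum_delta_eq (g * (w x)^-1)%g
    (fun a => R h x * P a (y * (v h)^-1)%g)).
  apply: eq_bigr => a _; rewrite (coef_counit_UR hopf_c) cQ wE mulrA.
  congr ((nat_of_bool _)%:R * _ * _).
  by rewrite -(inj_eq (mulgI a)) mulKVg -[RHS](inj_eq (mulIg (w x))) mulgKV.
have Rr h x x' : R h (x * x')%g = R h x * R h x'.
  by rewrite (compR_comul hopf_c) mulrC.
have vM : {morph v : h h' / (h * h')%g}.
  move=> h h'; apply/esym/eqP/oner_b; rewrite -vE (compV_mul hopf_c).
  under eq_bigr => z _ do rewrite !vE.
  by rewrite (sum_delta (v h) (fun z => (z^-1 * _ == _)%g%:R)) mulKg eqxx.
have wM : {morph w : x x' / (x * x')%g}.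
  move=> x x'; apply/esym/eqP/oner_b; rewrite -wE (compU_comul hopf_c).
  under eq_bigr => a _ do rewrite !wE mulrC.
  by rewrite (sum_delta (w x) (fun z => (z^-1 * _ == _)%g%:R)) mulKg eqxx.
(* Take [compU_act] at [g = w x ^ h] and cancel [R h x], which is nonzero because r(h) is a
   character. *)
have wJ x h : w (x ^ v h)%g = (w x ^ h)%g.
  apply/esym/eqP/oner_b; rewrite -wE.
  have R0 : R h x != 0.
    apply/eqP => R0; have := compR1r hopf_c h; rewrite -(mulgV x) Rr R0 mul0r.
    by move/eqP; rewrite eq_sym oner_eq0.
  apply: (mulfI R0); have := compU_act hopf_c (w x ^ h)%g h x.
  under [X in _ = _ * X -> _]eq_bigr => z _ do rewrite vE.
  rewrite (sum_delta (v h) (fun z => U (w x ^ h) (x ^ z))%g) => <-.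
  by rewrite wE mulrC conjgE mulKVg mulgK eqxx.
(* The span condition yields a nonzero [c g 1 t y], so that P is nonzero at [g * (w t)^-1], which is
   therefore central. *)
have wZ g : exists2 a, (forall z, a ^ z = a)%g & exists t, g = (a * w t)%g.
  have [n /(_ g)] := span_source g; rewrite eqxx => sn1.
  have [[t y] /= ny|n0] := pickP (fun s : gT * gT => c g 1%g s.1 s.2 != 0).
    exists (g * (w t)^-1)%g; last by exists t; rewrite mulgKV.
    apply: (@compP_centl _ (y * (v 1)^-1)%g); apply: contraNneq ny => P0.
    by rewrite cE P0 mulr0.
  move/eqP: sn1; rewrite big1 ?(eq_sym 0) ?oner_eq0 // => s _.
  by have := n0 s; case: eqP => // ->; rewrite mulr0.
have vZ y : exists2 b, (forall z, b ^ z = b)%g & exists t, y = (b * v t)%g.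
  have [n /(_ y)] := span_target y; rewrite eqxx => sn1.
  have [[g t] /= ny|n0] := pickP (fun s : gT * gT => c s.1 s.2 1%g y != 0).
    exists (y * (v t)^-1)%g; last by exists t; rewrite mulgKV.
    by apply: (@compP_centr g); rewrite -cQ.
  move/eqP: sn1; rewrite big1 ?(eq_sym 0) ?oner_eq0 // => s _.
  by have := n0 s; case: eqP => // ->; rewrite mulr0.
exists v, w; split=> //.
- exact: compP_centl.
- exact: compP_centr.
- exact: compP_inv.
- exact: compR_mul.
- exact: compR1l.
- exact: compR1r.
(* Modulo central factors x is v(t) and h is w(s). Then w(s)^w(x) = w(s^x) = w(s^v(t)) = w(s)^t, so
   h^w(x) = h^t, and v(h^t) = v(h)^v(t) = v(h)^x. *)
move=> h x; have [b cb [t xE]] := vZ x; have [a ca [s hE]] := wZ h.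
have Jx y : (y ^ x = y ^ v t)%g by rewrite xE conjgM (conj_central y cb).
rewrite Jx -morphJg //; congr v.
by rewrite hE !conjMg !ca -morphJg // -wJ Jx.
Qed.

End Shape.

(** * The Hopf identities for the flipped coefficients *)

Section Flip.
Variables (c : gT -> gT -> gT -> gT -> k) (P R : gT -> gT -> k).
Variables (v w : gT -> gT).
Hypotheses (hopf_c : hopf_coef c) (shape_c : aut_shape c P R v w).
Let cE := shapeE shape_c.
Let vM := shapev shape_c.
Let wM := shapew shape_c.

Lemma shape_classl a b z : P (a ^ z)%g b = P a b.
Proof.
have [P0|/(shape_centl shape_c)->//] := eqVneq (P a b) 0.
rewrite P0; apply/eqP; apply: contraT => nz.
move: (nz); have := shape_centl shape_c nz z^-1%g.
by rewrite conjgK => <-; rewrite P0 eqxx.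
Qed.

Lemma shape_classr a b z : P a (b ^ z)%g = P a b.
Proof.
have [P0|/(shape_centr shape_c)->//] := eqVneq (P a b) 0.
rewrite P0; apply/eqP; apply: contraT => nz.
move: (nz); have := shape_centr shape_c nz z^-1%g.
by rewrite conjgK => <-; rewrite P0 eqxx.
Qed.

Lemma shapeRlJ h x z : R (h ^ z)%g x = R h x.
Proof.
rewrite conjgE !(shapeRl shape_c) mulrCA -(shapeRl shape_c) mulVg.
by rewrite (shapeR1l shape_c) mulr1.
Qed.

Lemma shapeRrJ h x z : R h (x ^ z)%g = R h x.
Proof.
rewrite conjgE !(shapeRr shape_c) mulrCA -(shapeRr shape_c) mulVg.
by rewrite (shapeR1r shape_c) mulr1.
Qed.

Lemma shapeRV h x : R h^-1%g x = R h x^-1%g.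
Proof.
have R0 : R h x != 0.
  apply/eqP => R0; have := shapeR1r shape_c h; rewrite -(mulgV x).
  by rewrite (shapeRr shape_c) R0 mul0r => /eqP; rewrite eq_sym oner_eq0.
apply: (mulfI R0); rewrite -(shapeRl shape_c) -(shapeRr shape_c) !mulgV.
by rewrite (shapeR1l shape_c) (shapeR1r shape_c).
Qed.

(** Nonvanishing makes [z] a central multiple of [w h], so [v (x ^ z) = v x ^ h]; this conjugation
    is moved to [g'] as P is a class function. *)
Lemma coef_conj_source z x h g t h' g' : c z x h g != 0 ->
  c t (x ^ z)%g h' g' = c t x h' (h * g' * h^-1)%g.
Proof.
rewrite cE mulf_eq0 negb_or => /andP[_ /(shape_centl shape_c) cz].
have -> : (x ^ z = x ^ w h)%g.
  by rewrite -[z](mulgKV (w h)) conjgM (conj_central x cz).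
rewrite !cE shapeRlJ (shapevJ shape_c); congr (_ * _).
rewrite -[RHS](shape_classr _ _ h) conjMg; congr (P _ (_ * _)%g).
  by rewrite conjgE !mulgA mulVg mul1g mulgKV.
by rewrite conjVg.
Qed.

(** Dually, [a] is a central multiple of [v x'], so [w (h ^ a) = w h ^ x']. *)
Lemma coef_conj_target y' x' h a y x t : c y' x' h a != 0 ->
  c (y ^ x')%g x (h ^ a)%g t = c y x h t.
Proof.
rewrite cE mulf_eq0 negb_or => /andP[_ /(shape_centr shape_c) ca].
have -> : (h ^ a = h ^ v x')%g.
  by rewrite -[a](mulgKV (v x')) conjgM (conj_central h ca).
rewrite !cE shapeRrJ (shapewJ shape_c) -conjVg -conjMg.
by rewrite shape_classl.
Qed.

Lemma hopf_coef_flip : hopf_coef (fun y x h g => c g h x y).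
Proof.
split=> [g h g' h' x y|x y|g h x y x' y'|g h|g h x y].
(* Comultiplicativity of [c] evaluates this sum; it agrees termwise with the required one wherever
   [c z x h g] is nonzero. *)
- transitivity (\sum_z c z x h g * c (z^-1 * y)%g x h' (h * g' * h^-1)%g).
    under eq_bigr => z _ do rewrite mulrC.
    rewrite -(hopf_coef_comul hopf_c) eq_sym.
    by case: eqVneq => [->|_]; rewrite ?mul0r.
  apply: eq_bigr => z _.
  have [->|ne0] := eqVneq (c z x h g) 0; first by rewrite !mul0r.
  by rewrite (coef_conj_source _ _ _ ne0).
- exact: hopf_coef_counit.
- transitivity (\sum_a c y' x' h a * c (y ^ x')%g x (h ^ a)%g (a^-1 * g)%g).
    rewrite -(hopf_coefM hopf_c) -eq_conjg (inj_eq (conjg_inj x')).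
    by case: eqVneq => [->|_]; rewrite ?mul0r.
  apply: eq_bigr => a _; rewrite mulrC.
  have [->|ne0] := eqVneq (c y' x' h a) 0; first by rewrite !mulr0.
  by rewrite (coef_conj_target _ _ _ ne0).
- exact: hopf_coef1.
have PC a b b' : P a (b * b')%g = P a (b' * b)%g.
  by apply: (conj_invariantC (f := P a)) => *; apply: shape_classr.
have CP a a' b : P (a * a')%g b = P (a' * a)%g b.
  by apply: (conj_invariantC (f := P ^~ b)) => *; apply: shape_classl.
rewrite !cE shapeRV shapeRlJ; congr (_ * _).
rewrite !(morphVg vM, morphVg wM) !invgK -[RHS](shapeV shape_c).
rewrite !invMg !invgK -[RHS](shape_classr _ _ h) conjMg (conjVg (v _)).
rewrite -(shapevJ shape_c) -conjgM PC !(CP (w h)).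
(* The two sides now differ by [x] against [x ^ a]: either [P a] is somewhere nonzero and [a] is
   central, or both sides vanish. *)
set a := (y * w h)%g.
have [b Pab|P0] := pickP (fun b => P a b != 0).
  by rewrite (conj_central x (shape_centl shape_c Pab)).
by apply: etrans (eqP (negbFE (P0 _))) (esym (eqP (negbFE (P0 _)))).
Qed.
End Flip.
End Rigidity.

(** * Flipping as an operation on linear endomorphisms *)

Section Flipping.
Variables (k : fieldType) (gT : finGroupType).
Local Notation D := (drinfeld k gT).
Implicit Types (psi phi : 'End(D)) (a : {ffun gT -> k^o}).

Lemma coef_comp psi phi g h x y :
  coef (psi \o phi)%VF g h x y =
    \sum_s coef phi g h s.1 s.2 * coef psi s.1 s.2 x y.
Proof. by rewrite /coef comp_lfunE dcoef_lfun. Qed.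

Lemma coef_id g h x y :
  coef (\1%VF : 'End(D)) g h x y = ((x == g) && (y == h))%:R.
Proof. by rewrite /coef id_lfunE dcoef_dbase. Qed.

Definition flip_fun psi (z : D) : D :=
  mkdrinfeld (fun h g => \sum_s dcoef z s.1 s.2 * coef psi g h s.2 s.1).

Lemma flip_fun_linear psi : linear (flip_fun psi).
Proof.
move=> l y z; apply: drinfeldP => h g.
rewrite dcoefD dcoefZ !mkdrinfeldE mulr_sumr -big_split.
by apply: eq_bigr => s _; rewrite dcoefD dcoefZ mulrDl mulrA.
Qed.

HB.instance Definition _ psi :=
  GRing.isLinear.Build k D D _ (flip_fun psi) (flip_fun_linear psi).

(* The flip is the transpose of [psi] for the identification of the dual of
   k^G # kG with itself that exchanges the two factors. *)
Definition flip_lfun psi : 'End(D) := linfun (flip_fun psi).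

Lemma coef_flip psi y x h g : coef (flip_lfun psi) y x h g = coef psi g h x y.
Proof. by rewrite /coef lfunE mkdrinfeldE sum_dbase. Qed.

Lemma flip_lfunK : involutive flip_lfun.
Proof. by move=> psi; apply: lfun_eq_coef => *; rewrite !coef_flip. Qed.

Lemma flip_lfun1 : flip_lfun \1%VF = \1%VF.
Proof.
apply: lfun_eq_coef => g h x y; rewrite coef_flip !coef_id andbC.
by rewrite (eq_sym h) (eq_sym g).
Qed.

Lemma flip_lfun_comp psi phi :
  flip_lfun (psi \o phi)%VF = (flip_lfun phi \o flip_lfun psi)%VF.
Proof.
apply: lfun_eq_coef => y x h g; rewrite coef_flip !coef_comp.
rewrite [RHS](reindex_inj (h := fun s : gT * gT => (s.2, s.1))) /=; last first.
  by move=> [? ?] [? ?] [-> ->].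
by apply: eq_bigr => s _; rewrite !coef_flip mulrC.
Qed.

(** * Components of the flip *)

Lemma comp_pE psi a y : comp_p psi a y = \sum_g a g * compP (coef psi) g y.
Proof.
rewrite ffunE dcoef_lfun; under eq_bigr => s _ do rewrite mkdrinfeldE ffunE.
rewrite -(pair_bigA _ (fun g h => a g * (h == 1%g)%:R * coef psi g h 1%g y)).
apply: eq_bigr => g _ /=; under eq_bigr => h _ do rewrite -mulrA mulrCA.
by rewrite (sum_delta 1%g (fun h => a g * coef psi g h 1%g y)).
Qed.

Lemma comp_uE psi a x : comp_u psi a x = \sum_g a g * compU (coef psi) g x.
Proof.
rewrite ffunE; under eq_bigr => y _ do rewrite dcoef_lfun.
rewrite exchange_big.
transitivity (\sum_g \sum_h a g * (h == 1%g)%:R * \sum_y coef psi g h x y).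
  rewrite [RHS]pair_bigA; apply: eq_bigr => s _ /=.
  by rewrite mulr_sumr; apply: eq_bigr => y _; rewrite mkdrinfeldE ffunE.
apply: eq_bigr => g _ /=; under eq_bigr => h _ do rewrite -mulrA mulrCA.
by rewrite (sum_delta 1%g (fun h => a g * \sum_y coef psi g h x y)).
Qed.

Lemma comp_vE psi a y : comp_v psi a y = \sum_h a h * compV (coef psi) h y.
Proof.
rewrite ffunE dcoef_lfun; under [RHS]eq_bigr => h _ do rewrite mulr_sumr.
rewrite exchange_big pair_bigA; apply: eq_bigr => s _ /=.
by rewrite mkdrinfeldE ffunE mul1r.
Qed.

Lemma comp_rE psi a x : comp_r psi a x = \sum_h a h * compR (coef psi) h x.
Proof.
rewrite ffunE; under eq_bigr => y _ do rewrite dcoef_lfun.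
rewrite exchange_big; under [RHS]eq_bigr => h _ do rewrite mulr_sumr.
rewrite [RHS]exchange_big [RHS]pair_bigA; apply: eq_bigr => s _ /=.
by rewrite mulr_sumr; apply: eq_bigr => y _; rewrite mkdrinfeldE ffunE mul1r.
Qed.

Lemma sum_dirac (i : gT) (F : gT -> k) :
  \sum_j (dirac k i : {ffun _}) j * F j = F i.
Proof.
by rewrite -[RHS](sum_delta i); apply: eq_bigr => j _; rewrite ffunE.
Qed.

Lemma flip_lfun_components psi :
  [/\ comp_p (flip_lfun psi) =1 transpose (comp_p psi),
      comp_u (flip_lfun psi) =1 transpose (comp_v psi),
      comp_r (flip_lfun psi) =1 transpose (comp_r psi) &
      comp_v (flip_lfun psi) =1 transpose (comp_u psi)].
Proof.
split=> a; apply/ffunP => i; rewrite [RHS]ffunE.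
- rewrite comp_pE; apply: eq_bigr => j _.
  by rewrite comp_pE sum_dirac /compP coef_flip.
- rewrite comp_uE; apply: eq_bigr => j _; rewrite comp_vE sum_dirac.
  by congr (_ * _); apply: eq_bigr => g _; rewrite coef_flip.
- rewrite comp_rE; apply: eq_bigr => j _; rewrite comp_rE sum_dirac.
  congr (_ * _); rewrite /compR exchange_big; apply: eq_bigr => g _.
  by apply: eq_bigr => y _; rewrite coef_flip.
- rewrite comp_vE; apply: eq_bigr => j _; rewrite comp_uE sum_dirac.
  by congr (_ * _); apply: eq_bigr => g _; rewrite coef_flip.
Qed.

(** By [coef_components] all coefficients are functions of the four components; this makes the flip
    unique. *)
Lemma hopf_morphism_eq psi phi : hopf_morphism psi -> hopf_morphism phi ->
    comp_p psi =1 comp_p phi -> comp_u psi =1 comp_u phi ->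
    comp_r psi =1 comp_r phi -> comp_v psi =1 comp_v phi ->
  psi = phi.
Proof.
move=> /hopf_morphismP hpsi /hopf_morphismP hphi ep eu er ev.
have eP g y : compP (coef psi) g y = compP (coef phi) g y.
  by have := ep (dirac k g) => /ffunP/(_ y); rewrite !comp_pE !sum_dirac.
have eU g x : compU (coef psi) g x = compU (coef phi) g x.
  by have := eu (dirac k g) => /ffunP/(_ x); rewrite !comp_uE !sum_dirac.
have eR h x : compR (coef psi) h x = compR (coef phi) h x.
  by have := er (dirac k h) => /ffunP/(_ x); rewrite !comp_rE !sum_dirac.
have eV h y : compV (coef psi) h y = compV (coef phi) h y.
  by have := ev (dirac k h) => /ffunP/(_ y); rewrite !comp_vE !sum_dirac.
apply: lfun_eq_coef => g h x y.
rewrite (coef_components hpsi) (coef_components hphi); apply: eq_bigr => a _.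
by rewrite eU eR; congr (_ * _); apply: eq_bigr => z _; rewrite eP eV.
Qed.

(** * Flips of automorphisms *)

Lemma hopf_morphism_flip psi : is_hopf_aut psi -> hopf_morphism (flip_lfun psi).
Proof.
move=> apsi; have kpsi := is_hopf_aut_ker apsi.
have /hopf_morphismP hpsi := apsi.1; apply/hopf_morphismP.
have [z|z|v [w shape]] := aut_shape_components hpsi.
(* The coefficients in both span conditions are entries of the inverse matrix. *)
- exists (fun s => coef (psi^-1)%VF s.1 s.2 z 1%g) => g.
  under eq_bigr => s _ do rewrite mulrC.
  by rewrite -coef_comp lker0_compVf // coef_id eqxx andbT eq_sym.
- exists (fun s => coef (psi^-1)%VF 1%g z s.1 s.2) => y.
  by rewrite -coef_comp lker0_compfV // coef_id eqxx.
rewrite (_ : coef _ = fun y x h g => coef psi g h x y).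
  exact: hopf_coef_flip hpsi shape.
apply/funext => y; apply/funext => x; apply/funext => h; apply/funext => g.
exact: coef_flip.
Qed.

(** Flipping reverses compositions and fixes the identity, so the flip of the inverse is inverse to
    the flip. *)
Lemma is_hopf_aut_flip psi : is_hopf_aut psi -> is_hopf_aut (flip_lfun psi).
Proof.
move=> apsi; split; first exact: hopf_morphism_flip.
have kpsi := is_hopf_aut_ker apsi.
exists (flip_lfun (psi^-1)%VF) => z; rewrite -comp_lfunE -flip_lfun_comp.
  by rewrite lker0_compfV // flip_lfun1 id_lfunE.
by rewrite lker0_compVf // flip_lfun1 id_lfunE.
Qed.

Lemma is_flip_flip_lfun psi : is_hopf_aut psi -> is_flip psi (flip_lfun psi).
Proof.
by move=> apsi; split;
  [exact: hopf_morphism_flip | exact: flip_lfun_components].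
Qed.

Lemma is_flip_unique psi phi :
  is_hopf_aut psi -> is_flip psi phi -> phi = flip_lfun psi.
Proof.
move=> /is_flip_flip_lfun[hf [fp fu fr fv]] [hphi [ep eu er ev]].
by apply: hopf_morphism_eq => // a; rewrite ?ep ?eu ?er ?ev ?fp ?fu ?fr ?fv.
Qed.

Definition hopf_aut_flip (f : hopf_aut k gT) : hopf_aut k gT :=
  HopfAut (introT (asboolP _) (is_hopf_aut_flip (hopf_autP f))).

End Flipping.

Theorem theorem3p5 (k : closedFieldType) (gT : finGroupType)
    (char_k : [pchar k]%R =i pred0) :
  [/\ forall psi : hopf_aut k gT, flippable psi,
      forall (psi : hopf_aut k gT) (phi : 'End(drinfeld k gT)),
        is_flip psi phi -> is_hopf_aut phi
    & exists flip : hopf_aut k gT -> hopf_aut k gT,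
        [/\ forall psi : hopf_aut k gT, is_flip psi (flip psi),
            bijective flip
          & forall f g : hopf_aut k gT,
              flip (f * g)%g = (flip g * flip f)%g]].
Proof.
split=> [psi|psi phi|].
- by exists (flip_lfun psi); apply/is_flip_flip_lfun/hopf_autP.
- by move/(is_flip_unique (hopf_autP psi))->; apply/is_hopf_aut_flip/hopf_autP.
exists (@hopf_aut_flip k gT); split=> [psi||f g].
- exact/is_flip_flip_lfun/hopf_autP.
(* Being an involution, flipping is its own inverse. *)
- by exists (@hopf_aut_flip k gT) => f; apply: val_inj; apply: flip_lfunK.
- by apply: val_inj; apply: flip_lfun_comp.
Qed.
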